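(* Under the homomorphism $\psi:\Delta_q\to\hat H_q$ the image of the Casimir element $\Omega$ is $$(q+q^{-1})^2-(q^{-1}t_0+qt_0^{-1})^2-(t_1+t_1^{-1})^2-(t_2+t_2^{-1})^2-(t_3+t_3^{-1})^2-(q^{-1}t_0+qt_0^{-1})(t_1+t_1^{-1})(t_2+t_2^{-1})(t_3+t_3^{-1}).$$
   Context: Algebras are associative with multiplicative identity $1$. $\mathbb F$ is a field and $q\in\mathbb F$ is nonzero with $q^4\neq 1$. The universal Askey--Wilson algebra $\Delta_q$ is the $\mathbb F$-algebra defined by generators $A,B,C$ and the relations asserting that each of $$A+\frac{qBC-q^{-1}CB}{q^2-q^{-2}},\qquad B+\frac{qCA-q^{-1}AC}{q^2-q^{-2}},\qquad C+\frac{qAB-q^{-1}BA}{q^2-q^{-2}}$$ is central in $\Delta_q$. The central elements $\alpha,\beta,\gamma$ of $\Delta_q$ are obtained by multiplying these three elements, respectively, by $q+q^{-1}$. The Casimir element of $\Delta_q$ is $$\Omega=q^{-1}ACB+q^{-2}A^2+q^{-2}B^2+q^{2}C^2-q^{-1}A\alpha-q^{-1}B\beta-qC\gamma.$$ The universal DAHA of type $(C_1^\vee,C_1)$, denoted $\hat H_q$, is the $\mathbb F$-algebra defined by generators $t_i^{\pm1}$ ($i\in\{0,1,2,3\}$) and relations: (i) $t_it_i^{-1}=t_i^{-1}t_i=1$ for each $i$; (ii) $t_i+t_i^{-1}$ is central for each $i$; (iii) $t_0t_1t_2t_3=q^{-1}$. The map $\psi:\Delta_q\to\hat H_q$ is the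 unique $\mathbb F$-algebra homomorphism that sends $A\mapsto t_1t_0+(t_1t_0)^{-1}$, $B\mapsto t_3t_0+(t_3t_0)^{-1}$, $C\mapsto t_2t_0+(t_2t_0)^{-1}$. *)

(* Defs.v *)
From HB Require Import structures.
From mathcomp Require Import all_boot all_order all_algebra.
From mathcomp Require Import generic_quotient ring_quotient.
From mathcomp Require Import boolp.
From mathcomp Require Import monalg.
From mathcomp Require Import ring.

Set Implicit Arguments.
Unset Strict Implicit.
Unset Printing Implicit Defensive.

Import GRing.Theory.
Local Open Scope ring_scope.
Local Open Scope quotient_scope.

Inductive ideal_span (A : nzRingType) (S : A -> Prop) : A -> Prop :=
| span_gen x of S x : ideal_span S x
| span_0 : ideal_span S 0
| span_B x y of ideal_span S x & ideal_span S y : ideal_span S (x - y)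
| span_M a x b of ideal_span S x : ideal_span S (a * x * b).

Lemma ideal_span_proper (A B : nzRingType) (f : {rmorphism A -> B})
    (S : A -> Prop) :
  (forall x, S x -> f x = 0) -> ~ ideal_span S 1.
Proof.
move=> fS I1; suff: f 1 = 0 by apply/eqP; rewrite rmorph1 oner_neq0.
elim: {1}1 / I1 => [x /fS||x y _ fx _ fy|a x b _ fx] //.
- by rewrite rmorph0.
- by rewrite rmorphB fx fy subrr.
- by rewrite !rmorphM fx mulr0 mul0r.
Qed.

Lemma rmorph_commutator (A B : nzRingType) (f : {rmorphism A -> B}) x y :
  f x * f y = f y * f x -> f (x * y - y * x) = 0.
Proof. by move=> fxy; rewrite rmorphB !rmorphM fxy subrr. Qed.

Lemma rmorph_addM_comm (A B : nzRingType) (f : {rmorphism A -> B}) x y z :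
  f ((x + y) * z) = f (z * (x + y)) -> (f x + f y) * f z = f z * (f x + f y).
Proof. by rewrite !rmorphM rmorphD. Qed.

(* MathComp only gives {ideal_quot _} a ring structure over commutative
   rings; [quotalg] is the quotient of an algebra by the two-sided ideal
   generated by [S].  Algebras being nontrivial in MathComp, the ideal has to
   be proper. *)
Section QuotientAlgebra.
Variables (F : fieldType) (A : algType F) (S : A -> Prop).

Definition idealp : {pred A} := fun x => `[< ideal_span S x >].

Fact idealp_zmod_closed : zmod_closed idealp.
Proof.
split; first by apply/asboolP; exact: span_0.
by move=> x y /asboolP Ix /asboolP Iy; apply/asboolP; exact: span_B.
Qed.

HB.instance Definition _ := GRing.isZmodClosed.Build A idealp
  idealp_zmod_closed.

Definition quot_type (proper : ~ ideal_span S 1) : Type :=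
  Quotient.quot idealp.

Variable proper : ~ ideal_span S 1.
Local Notation Q := (quot_type proper).

HB.instance Definition _ := GRing.Zmodule.copy Q (Quotient.quot idealp).

Definition qpi (x : A) : Q := \pi_(Quotient.quot idealp) x.
Definition qrepr (x : Q) : A := repr (x : Quotient.quot idealp).

Lemma qreprK : cancel qrepr qpi.
Proof. exact: reprK. Qed.

Lemma qpi_eq x y : qpi x = qpi y <-> ideal_span S (x - y).
Proof.
have E : (x - y \in idealp) = (qpi x == qpi y) :=
  Quotient.idealrBE idealp x y.
by split=> [/eqP|/asboolP] h; [apply/asboolP; move: h; rewrite -E
                              | apply/eqP; rewrite -E].
Qed.

Lemma qpiB : {morph qpi : x y / x - y}.
Proof. exact: (raddfB \pi_(Quotient.quot idealp)). Qed.

HB.instance Definition _ := GRing.isZmodMorphism.Build A Q qpi qpiB.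

(* The operations are locked to keep conversion from unfolding them. *)
Fact qop_key : unit. Proof. exact: tt. Qed.

Definition qone : Q := qpi 1.
Definition qmul : Q -> Q -> Q :=
  locked_with qop_key (fun x y => qpi (qrepr x * qrepr y)).
Definition qscale : F -> Q -> Q :=
  locked_with qop_key (fun c x => qpi (c *: qrepr x)).

Lemma qmulE x y : qmul (qpi x) (qpi y) = qpi (x * y).
Proof.
rewrite /qmul unlock; apply/qpi_eq; set x' := qrepr _; set y' := qrepr _.
have Ix : ideal_span S (x' - x) by apply/qpi_eq; rewrite qreprK.
have Iy : ideal_span S (y - y') by apply/qpi_eq; rewrite qreprK.
suff -> : x' * y' - x * y = 1 * (x' - x) * y' - x * (y - y') * 1.
  by apply: span_B; apply: span_M.
by rewrite mul1r mulr1 mulrBl mulrBr opprB addrA subrK.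
Qed.

Lemma qscaleE c x : qscale c (qpi x) = qpi (c *: x).
Proof.
rewrite /qscale unlock; apply/qpi_eq; set x' := qrepr _.
have Ix : ideal_span S (x' - x) by apply/qpi_eq; rewrite qreprK.
have -> : c *: x' - c *: x = c%:A * (x' - x) * 1.
  by rewrite mulr1 mulr_algl scalerBr.
exact: span_M.
Qed.

Lemma qW (P : Q -> Prop) : (forall a, P (qpi a)) -> forall x, P x.
Proof. by move=> Pa x; rewrite -[x]qreprK. Qed.

Local Ltac qcases := do ?[elim/qW => ?].

Fact qmulA : associative qmul.
Proof. by qcases; rewrite !qmulE mulrA. Qed.
Fact qmul1 : left_id qone qmul.
Proof. by qcases; rewrite !qmulE mul1r. Qed.
Fact qmulr1 : right_id qone qmul.
Proof. by qcases; rewrite !qmulE mulr1. Qed.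
Fact qmulDl : left_distributive qmul +%R.
Proof. by qcases; rewrite -raddfD !qmulE mulrDl raddfD. Qed.
Fact qmulDr : right_distributive qmul +%R.
Proof. by qcases; rewrite -raddfD !qmulE mulrDr raddfD. Qed.
Fact qone_neq0 : qone != 0.
Proof.
apply/eqP; rewrite /qone -[0](raddf0 qpi) => /qpi_eq.
by rewrite subr0.
Qed.

HB.instance Definition _ := GRing.Zmodule_isNzRing.Build Q
  qmulA qmul1 qmulr1 qmulDl qmulDr qone_neq0.

Fact qpi_monoid : monoid_morphism qpi.
Proof. by split=> // x y; rewrite -qmulE. Qed.

HB.instance Definition _ := GRing.isMonoidMorphism.Build A Q qpi
  qpi_monoid.

Fact qscaleA a b x : qscale a (qscale b x) = qscale (a * b) x.
Proof. by move: x; qcases; rewrite !qscaleE scalerA. Qed.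
Fact qscale1 : left_id 1 qscale.
Proof. by qcases; rewrite qscaleE scale1r. Qed.
Fact qscaleDr : right_distributive qscale +%R.
Proof. by move=> c; qcases; rewrite -raddfD !qscaleE scalerDr raddfD. Qed.
Fact qscaleDl x : {morph qscale^~ x : a b / a + b}.
Proof. by move: x; qcases => a b; rewrite !qscaleE scalerDl raddfD. Qed.

HB.instance Definition _ := GRing.Zmodule_isLmodule.Build F Q
  qscaleA qscale1 qscaleDr qscaleDl.

Lemma qpiZ : scalable qpi.
Proof. by move=> c x; rewrite -qscaleE. Qed.

HB.instance Definition _ := GRing.isScalable.Build F A Q *:%R qpi
  qpiZ.

Fact qscaleAl (c : F) (x y : Q) : c *: (x * y) = (c *: x) * y.
Proof.
by move: x y; qcases; rewrite -rmorphM -!linearZ -rmorphM scalerAl.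
Qed.
Fact qscaleAr (c : F) (x y : Q) : c *: (x * y) = x * (c *: y).
Proof.
by move: x y; qcases; rewrite -rmorphM -!linearZ -rmorphM scalerAr.
Qed.

HB.instance Definition _ := GRing.Lmodule_isLalgebra.Build F Q qscaleAl.
HB.instance Definition _ := GRing.Lalgebra_isAlgebra.Build F Q qscaleAr.

(* Inverses exist in [Q] by classical choice only. *)
Definition qunit : pred Q := fun x => `[< exists y, y * x = 1 /\ x * y = 1 >].
Definition qinv (x : Q) : Q :=
  if pselect (exists y, y * x = 1 /\ x * y = 1) is left h
  then sval (cid h) else x.

Fact qmulV : {in qunit, left_inverse 1 qinv *%R}.
Proof.
move=> x /asboolP ex; rewrite /qinv.
by case: pselect => [h|//]; case: cid => y [].
Qed.
Fact qdivV : {in qunit, right_inverse 1 qinv *%R}.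
Proof.
move=> x /asboolP ex; rewrite /qinv.
by case: pselect => [h|//]; case: cid => y [].
Qed.
Fact qunitP (x y : Q) : y * x = 1 /\ x * y = 1 -> qunit x.
Proof. by move=> h; apply/asboolP; exists y. Qed.
Fact qinv_out : {in [predC qunit], qinv =1 id}.
Proof.
move=> x /negP nx; rewrite /qinv; case: pselect => // h.
by case: nx; apply/asboolP.
Qed.

HB.instance Definition _ := GRing.NzRing_hasMulInverse.Build Q
  qmulV qdivV qunitP qinv_out.

Definition quotalg : unitAlgType F := Q.
Definition to_quot : {lrmorphism A -> quotalg} := qpi.

Lemma to_quot_eq x y : to_quot x = to_quot y <-> ideal_span S (x - y).
Proof. exact: qpi_eq. Qed.

Lemma to_quot_rel x y : S (x - y) -> to_quot x = to_quot y.
Proof. by move=> Sxy; apply/to_quot_eq/span_gen. Qed.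

Lemma quotW (P : quotalg -> Prop) :
  (forall a, P (to_quot a)) -> forall x, P x.
Proof. exact: qW. Qed.

Section Lift.
Variables (B : algType F) (f : {lrmorphism A -> B}).
Hypothesis fS : forall x, S x -> f x = 0.

Lemma ideal_span_ker x : ideal_span S x -> f x = 0.
Proof.
elim=> {x} [x /fS||x y _ fx _ fy|a x b _ fx] //.
- by rewrite rmorph0.
- by rewrite rmorphB /= fx fy subrr.
- by rewrite !rmorphM /= fx mulr0 mul0r.
Qed.

Definition qlift (x : quotalg) : B := f (qrepr x).

Lemma qliftE x : qlift (to_quot x) = f x.
Proof.
apply/eqP; rewrite -subr_eq0 -(raddfB f); apply/eqP/ideal_span_ker/qpi_eq.
exact: qreprK.
Qed.

Fact qliftB : {morph qlift : x y / x - y}.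
Proof.
elim/quotW => x; elim/quotW => y.
by rewrite -raddfB !qliftE raddfB.
Qed.

Fact qliftM : monoid_morphism qlift.
Proof.
split; first by rewrite -[1](rmorph1 to_quot) qliftE rmorph1.
elim/quotW => x; elim/quotW => y.
by rewrite -rmorphM !qliftE rmorphM.
Qed.

Fact qliftZ : scalable qlift.
Proof. by move=> c; elim/quotW => x; rewrite -linearZ !qliftE linearZ. Qed.

HB.instance Definition _ := GRing.isZmodMorphism.Build quotalg B qlift qliftB.
HB.instance Definition _ := GRing.isMonoidMorphism.Build quotalg B qlift
  qliftM.
HB.instance Definition _ := GRing.isScalable.Build F quotalg B *:%R qlift
  qliftZ.

Definition quot_lift : {lrmorphism quotalg -> B} := qlift.

Lemma quot_liftE x : quot_lift (to_quot x) = f x.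
Proof. exact: qliftE. Qed.

End Lift.
End QuotientAlgebra.
Arguments to_quot : simpl never.
Arguments quot_lift : simpl never.

Section FreeAlgebra.
Variables (F : fieldType) (X : choiceType).

(* An alias: the algebra structure of {malg _[_]} is reserved to commutative
   monoids. *)
Definition free_type : Type := {malg F[{fmonom X}]}.
HB.instance Definition _ := GRing.Lalgebra.on free_type.

Fact freealg_scaleAr (c : F) (x y : free_type) : c *: (x * y) = x * (c *: y).
Proof.
suff comm z : c%:MP * z = z * c%:MP :> {malg F[{fmonom X}]}.
  by rewrite -!mul_malgC mulrA comm -mulrA.
rewrite [z]monalgE mulr_sumr mulr_suml; apply: eq_bigr => k _.
by rewrite !malgM_def !fgmulUU mul1m mulm1 mulrC.
Qed.
HB.instance Definition _ := GRing.Lalgebra_isAlgebra.Build F free_type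
  freealg_scaleAr.

Definition freealg : algType F := free_type.

Fact fvar_key : unit. Proof. exact: tt. Qed.
Definition fvar : X -> freealg :=
  locked_with fvar_key (fun i => mkmalgU (fmu i) 1 : {malg F[{fmonom X}]}).

Variables (B : algType F) (h : X -> B).

Definition eval_mon (m : {fmonom X}) : B := \prod_(i <- m) h i.
Fact eval_monM : mmorphism eval_mon.
Proof.
by split=> [x y|]; rewrite /eval_mon ?fm1 ?big_nil // fmM big_cat.
Qed.
HB.instance Definition _ := isMultiplicative.Build {fmonom X} B eval_mon
  eval_monM.

Definition free_fun (x : freealg) : B := mmap (in_alg B) eval_mon x.

Fact free_funB : {morph free_fun : x y / x - y}.
Proof. exact: mmap_is_additive. Qed.
HB.instance Definition _ := GRing.isZmodMorphism.Build freealg B free_fun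
  free_funB.
Fact free_funM : monoid_morphism free_fun.
Proof.
have [M U] : multiplicative free_fun.
  apply: commr_mmap_is_multiplicative => g m m'.
  by rewrite /GRing.comm /= mulr_algl mulr_algr.
by split.
Qed.
HB.instance Definition _ := GRing.isMonoidMorphism.Build freealg B free_fun
  free_funM.
Fact free_funZ : scalable free_fun.
Proof. by move=> c x; rewrite /free_fun mmapZ mulr_algl. Qed.
HB.instance Definition _ := GRing.isScalable.Build F freealg B *:%R free_fun
  free_funZ.

Definition free_eval : {lrmorphism freealg -> B} := free_fun.

Lemma free_evalE i : free_eval (fvar i) = h i.
Proof.
by rewrite /free_eval /= /free_fun /fvar unlock mmapU /= scale1r mul1r /eval_mon fmU big_seq1.
Qed.

Lemma mkmalgU_prod (m : {fmonom X}) :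
  (mkmalgU m 1 : freealg) = \prod_(i <- m) fvar i.
Proof.
case: m => s; rewrite /=; elim: s => [|i s IH].
  by rewrite big_nil -fmoneE.
rewrite big_cons -IH /fvar unlock [RHS]malgM_def fgmulUU mulr1.
by congr (mkmalgU _ _); apply: val_inj; rewrite /= fmM fmU.
Qed.

Lemma free_eval_eq (f g : {lrmorphism freealg -> B}) :
  (forall i, f (fvar i) = g (fvar i)) -> f =1 g.
Proof.
move=> fg x.
have E c m : mkmalgU m c = c *: (\prod_(i <- m) fvar i) :> freealg.
  rewrite -mkmalgU_prod; apply/malgP => k.
  by rewrite [RHS]mcoeffZ !mcoeffU mulrnAr mulr1.
rewrite [x]monalgE !raddf_sum; apply: eq_bigr => m _; rewrite E.
have fZ (k : {lrmorphism freealg -> B}) :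
    k (x@_m *: (\prod_(i <- m) fvar i)) = x@_m *: \prod_(i <- m) k (fvar i).
  by rewrite linearZ /= rmorph_prod.
by rewrite /= !fZ; congr (_ *: _); apply: eq_bigr => i _.
Qed.

End FreeAlgebra.
Arguments free_eval : simpl never.

Section AWElement.
Variables (F : fieldType) (q : F) (R : algType F).

Definition aw_elt (x y z : R) : R :=
  x + (q ^+ 2 - q ^- 2)^-1 *: (q *: (y * z) - q^-1 *: (z * y)).

End AWElement.

Lemma rmorph_aw_elt (F : fieldType) (q : F) (A B : algType F)
    (f : {lrmorphism A -> B}) x y z :
  f (aw_elt q x y z) = aw_elt q (f x) (f y) (f z).
Proof.
have fZ c u : f (c *: u) = c *: f u by rewrite linearZ.
by rewrite /aw_elt rmorphD /= fZ rmorphB /= !fZ !rmorphM.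
Qed.


(* The generators of [Delta q] are indexed by 'I_3: A, B, C are numbered
   0, 1, 2. *)
Section UniversalAskeyWilson.
Variables (F : fieldType) (q : F).

Local Notation A := (fvar F (0 : 'I_3)).
Local Notation B := (fvar F (1 : 'I_3)).
Local Notation C := (fvar F (2 : 'I_3)).

Inductive Delta_rel : freealg F 'I_3 -> Prop :=
| Delta_relA y : Delta_rel (aw_elt q A B C * y - y * aw_elt q A B C)
| Delta_relB y : Delta_rel (aw_elt q B C A * y - y * aw_elt q B C A)
| Delta_relC y : Delta_rel (aw_elt q C A B * y - y * aw_elt q C A B).

Lemma Delta_proper : ~ ideal_span Delta_rel 1.
Proof.
apply: (ideal_span_proper (f := free_eval (fun _ : 'I_3 => 0 : F^o))).
by move=> _ [] y; apply: rmorph_commutator; apply: (@mulrC F).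
Qed.

Definition Delta : unitAlgType F := quotalg Delta_proper.

Definition dA : Delta := to_quot Delta_proper A.
Definition dB : Delta := to_quot Delta_proper B.
Definition dC : Delta := to_quot Delta_proper C.

Definition alpha : Delta := (q + q^-1) *: aw_elt q dA dB dC.
Definition beta : Delta := (q + q^-1) *: aw_elt q dB dC dA.
Definition gamma : Delta := (q + q^-1) *: aw_elt q dC dA dB.

Definition Omega : Delta :=
  q^-1 *: (dA * dC * dB)
  + q ^- 2 *: dA ^+ 2 + q ^- 2 *: dB ^+ 2 + q ^+ 2 *: dC ^+ 2
  - q^-1 *: (dA * alpha) - q^-1 *: (dB * beta) - q *: (dC * gamma).

End UniversalAskeyWilson.

(* The generators t_i and t_i^-1 of [Hhat q0] are the variables (i, false) and
   (i, true).  The condition q != 0 makes the algebra nontrivial. *)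
Section UniversalDAHA.
Variables (F : fieldType) (q : F) (q0 : q != 0).

Local Notation t i := (fvar F ((i, false) : 'I_4 * bool)).
Local Notation t' i := (fvar F ((i, true) : 'I_4 * bool)).

Inductive Hhat_rel : freealg F ('I_4 * bool)%type -> Prop :=
| Hhat_rel_divr i : Hhat_rel (t i * t' i - 1)
| Hhat_rel_mulV i : Hhat_rel (t' i * t i - 1)
| Hhat_rel_central i y : Hhat_rel ((t i + t' i) * y - y * (t i + t' i))
| Hhat_rel_prod : Hhat_rel (t 0 * t 1 * t 2 * t 3 - q^-1%:A).

Lemma Hhat_proper : ~ ideal_span Hhat_rel 1.
Proof.
pose g (v : 'I_4 * bool) : F^o :=
  if v.1 == 0 then if v.2 then q else q^-1 else 1.
apply: (ideal_span_proper (f := free_eval g)).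
move=> _ [i|i|i y|].
- rewrite rmorphB rmorphM rmorph1 /= !free_evalE /g /=.
  by case: eqP; rewrite ?mulVf ?mulr1 ?subrr.
- rewrite rmorphB rmorphM rmorph1 /= !free_evalE /g /=.
  by case: eqP; rewrite ?mulfV ?mulr1 ?subrr.
- by apply: rmorph_commutator; apply: (@mulrC F).
- rewrite rmorphB !rmorphM /= !free_evalE linearZ rmorph1 /g /= !mulr1.
  by rewrite [_%:A]mulr1 subrr.
Qed.

Definition Hhat : unitAlgType F := quotalg Hhat_proper.

Definition tgen (i : 'I_4) : Hhat := to_quot Hhat_proper (t i).

Lemma tgen_inv_rel i : tgen i * to_quot Hhat_proper (t' i) = 1
                    /\ to_quot Hhat_proper (t' i) * tgen i = 1.
Proof.
split.
- have := to_quot_rel Hhat_proper (Hhat_rel_divr i).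
  by rewrite rmorphM rmorph1.
- have := to_quot_rel Hhat_proper (Hhat_rel_mulV i).
  by rewrite rmorphM rmorph1.
Qed.

Lemma tgen_unit i : tgen i \is a GRing.unit.
Proof.
have [e1 e2] := tgen_inv_rel i.
by apply/unitrP; exists (to_quot Hhat_proper (t' i)); split.
Qed.

Lemma tgenV i : (tgen i)^-1 = to_quot Hhat_proper (t' i).
Proof.
by rewrite -[LHS]mulr1 -(tgen_inv_rel i).1 mulKr // tgen_unit.
Qed.

Lemma tgen_central i (y : Hhat) :
  (tgen i + (tgen i)^-1) * y = y * (tgen i + (tgen i)^-1).
Proof.
elim/quotW: y => y; rewrite tgenV.
exact: rmorph_addM_comm (to_quot_rel Hhat_proper (Hhat_rel_central i y)).
Qed.

Lemma tgen_prod : tgen 0 * tgen 1 * tgen 2 * tgen 3 = q^-1%:A.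
Proof.
have := to_quot_rel Hhat_proper Hhat_rel_prod.
by rewrite !rmorphM linearZ rmorph1.
Qed.

End UniversalDAHA.

(* The tactic [lin F V] proves an identity between linear combinations in the
   F-module V up to the identities between the coefficients. *)
Section LinearCombinations.
Variables (F : fieldType) (V : lmodType F).

Inductive lexp := LAtom of nat | LZero | LAdd of lexp & lexp | LOpp of lexp
                | LScale of F & lexp.

Fixpoint lden (env : seq V) (e : lexp) : V :=
  match e with
  | LAtom n => nth 0 env n
  | LZero => 0
  | LAdd e1 e2 => lden env e1 + lden env e2
  | LOpp e => - lden env e
  | LScale c e => c *: lden env e
  end.

Fixpoint lcoef (e : lexp) (i : nat) : F :=
  match e with
  | LAtom n => if i == n then 1 else 0
  | LZero => 0
  | LAdd e1 e2 => lcoef e1 i + lcoef e2 i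
  | LOpp e => - lcoef e i
  | LScale c e => c * lcoef e i
  end.

Lemma ldenE env e : lden env e = \sum_(i < size env) lcoef e i *: env`_i.
Proof.
elim: e => [n||e1 IH1 e2 IH2|e IH|c e IH] /=.
- have [lt|ge] := ltnP n (size env).
    rewrite (bigD1 (Ordinal lt)) //= eqxx scale1r big1 ?addr0 // => i ni.
    by rewrite ifN ?scale0r.
  rewrite nth_default // big1 // => i _.
  by rewrite ifN ?scale0r // neq_ltn (leq_trans (ltn_ord i) ge).
- by rewrite big1 // => i _; rewrite scale0r.
- by rewrite IH1 IH2 -big_split; apply: eq_bigr => i _; rewrite scalerDl.
- by rewrite IH -sumrN; apply: eq_bigr => i _; rewrite scaleNr.
- by rewrite IH scaler_sumr; apply: eq_bigr => i _; rewrite scalerA.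
Qed.

Fixpoint lagree (e1 e2 : lexp) (n : nat) : Prop :=
  if n is n'.+1 then lcoef e1 n' = lcoef e2 n' /\ lagree e1 e2 n' else True.

Lemma lden_eq env e1 e2 :
  lagree e1 e2 (size env) -> lden env e1 = lden env e2.
Proof.
move=> h; rewrite !ldenE; apply: eq_bigr => -[i /= lt] _; congr (_ *: _).
elim: (size env) lt h => //= n IH; rewrite ltnS leq_eqVlt.
by case/orP => [/eqP -> []|lt [_ /(IH lt)]].
Qed.

End LinearCombinations.

Ltac lin_atoms env t :=
  match t with
  | ?x + ?y => let env := lin_atoms env x in lin_atoms env y
  | - ?x => lin_atoms env x
  | _ *: ?x => lin_atoms env x
  | 0 => env
  | _ =>
    let rec mem e := match e with
      | cons ?u _ => let _ := constr:(erefl : t = u) in env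
      | cons _ ?e' => mem e' | nil => constr:(cons t env) end
    in mem env
  end.
Ltac lin_index env t :=
  match env with
  | cons ?u _ => let _ := constr:(erefl : t = u) in constr:(O)
  | cons _ ?e => let n := lin_index e t in constr:(S n)
  end.
Ltac lin_reify F env t :=
  match t with
  | ?x + ?y => let x := lin_reify F env x in let y := lin_reify F env y in
               constr:(LAdd x y)
  | - ?x => let x := lin_reify F env x in constr:(LOpp x)
  | ?c *: ?x => let x := lin_reify F env x in constr:(LScale c x)
  | 0 => constr:(LZero F)
  | _ => let n := lin_index env t in constr:(LAtom F n)
  end.
Ltac lin F V :=
  match goal with |- ?x = ?y =>
    let env := lin_atoms (@nil V) x in
    let env := lin_atoms env y in
    let ex := lin_reify F env x in
    let ey := lin_reify F env y in
    change (@lden F V env ex = @lden F V env ey); apply: lden_eq;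
    rewrite /=; repeat split
  end.

Section Admissible.
Variables (F : fieldType) (q : F) (R : algType F).

Definition central (z : R) := forall y, z * y = y * z.

(* a, b, c, d stand for t_0, t_2, t_3, t_1 and the primed variables for their
   inverses. *)
Section Four.
Variables (a a' b b' c c' d d' : R).

Record admissible : Prop := Admissible {
  adm_a : a * a' = 1; adm_a' : a' * a = 1;
  adm_b : b * b' = 1; adm_b' : b' * b = 1;
  adm_c : c * c' = 1; adm_c' : c' * c = 1;
  adm_d : d * d' = 1; adm_d' : d' * d = 1;
  adm_p : central (a + a'); adm_r : central (b + b');
  adm_s : central (c + c'); adm_T : central (d + d');
  adm_q : a * d * b * c = q^-1%:A }.

End Four.

(* An element x y + (x y)^-1 commutes with y. *)
Lemma sum_inv_comm (x x' y y' : R) :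
  x * x' = 1 -> x' * x = 1 -> y * y' = 1 -> y' * y = 1 ->
  central (x + x') -> central (y + y') ->
  x * y + y' * x' = y * x + x' * y'.
Proof.
move=> xx' x'x yy' y'y cx cy.
have -> : y' * x' = (y + y') * x' - y * x' by rewrite mulrDl; lin F R; ring.
have -> : x' * y' = (y + y') * x' - x' * y.
  by rewrite cy mulrDr; lin F R; ring.
have : (x + x') * y = y * (x + x') by [].
rewrite mulrDl mulrDr => /(canRL (addrK _)) ->.
by lin F R; ring.
Qed.

End Admissible.
Section KeyIdentity.
Variables (F : fieldType) (q : F) (q0 : q != 0).
Variables (R : algType F).
Variables (a a' b b' c c' d d' : R).
Hypothesis h : admissible q a a' b b' c c' d d'.
Local Notation p := (a + a').
Local Notation r := (b + b').
Local Notation s := (c + c').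
Local Notation T := (d + d').

Lemma admE : d = q^-1 *: (a' * c' * b') /\ d' = q *: (b * c * a).
Proof.
case: h => aa a'a bb b'b cc c'c dd d'd _ _ _ _ e.
have e1 : d = q^-1 *: (a' * c' * b').
  have := congr1 (fun z => a' * z * c' * b') e.
  rewrite !mulrA a'a mul1r -(mulrA _ c) cc mulr1 -(mulrA _ b) bb mulr1 => ->.
  by rewrite mulr_algr -!scalerAl.
split=> //; rewrite -[LHS]mulr1 -[X in d' * X](_ : d * (q *: (b * c * a)) = 1).
  by rewrite mulrA d'd mul1r.
rewrite e1 -scalerAl -scalerAr scalerA mulVf // scale1r !mulrA.
by rewrite -(mulrA _ b') b'b mulr1 -(mulrA _ c') c'c mulr1.
Qed.

Lemma key :
  q *: ((c * a + a' * c') * (b * a + a' * b'))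
    - q^-1 *: ((b * a + a' * b') * (c * a + a' * c'))
    + (q ^+ 2 - q ^- 2) *: (d * a + a' * d')
  = (q - q^-1) *: ((q^-1 *: a + q *: a') * T + r * s).
Proof.
have [eqd eqd'] := admE.
case: (h) => aa a'a bb b'b cc c'c dd d'd cp cr cs cT e.
have commC : b * a + a' * b' = a * b + b' * a' by exact: sum_inv_comm.
have commA : d * a + a' * d' = a * d + d' * a' by exact: sum_inv_comm.
have eA : d * a + a' * d' = q^-1 *: (c' * b') + q *: (b * c).
  rewrite commA eqd eqd' -scalerAr -scalerAl !mulrA aa mul1r.
  by rewrite -(mulrA _ a) aa mulr1.
have ETd : T = q *: (b * c * a) + q^-1 *: (a' * c' * b').
  by rewrite eqd {1}eqd' addrC.
pose W := b' * a' * c'.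
have Hcab : c * a * b = q^-1 *: (T - q^-1 *: W).
  have : b' * T * b = T by rewrite -(mulrA b') cT mulrA b'b mul1r.
  rewrite {1}ETd mulrDr mulrDl -!scalerAr -!scalerAl !mulrA b'b mul1r.
  rewrite -(mulrA _ b' b) b'b mulr1 -/W => <-.
  by lin F R; field.
have Habc : c' * b' * a' = q *: (T - q *: (a * b * c)).
  have : a * T * a' = T by rewrite -(mulrA a) cT mulrA aa mul1r.
  rewrite {1}ETd mulrDr mulrDl -!scalerAr -!scalerAl !mulrA aa mul1r.
  rewrite -(mulrA _ a a') aa mulr1 => <-.
  by lin F R; field.
have aa2 : a * a = p * a - 1.
  by rewrite mulrDl a'a addrK.
have a'a'2 : a' * a' = p * a' - 1.
  by rewrite mulrDl aa addrC addKr.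
have H1 : c * a * a * b = p * (c * a * b) - c * b.
  by rewrite -(mulrA c) aa2 mulrBr mulrBl mulr1 !mulrA cp.
have H2 : c * a * b' * a' = r * c - c * a * b * a'.
  have -> : c * a * b' = r * (c * a) - c * a * b.
    by rewrite cr mulrDr addrC addKr.
  by rewrite mulrBl -!mulrA aa mulr1.
have H3 : a' * c' * a * b = s * b - a' * c * a * b.
  have -> : a' * c' = a' * s - a' * c by rewrite mulrDr addrC addKr.
  by rewrite -cs !mulrBl -!(mulrA s) a'a mul1r.
have H4 : a' * c' * b' * a' = q *: (a' * T) - q ^+ 2 *: (b * c).
  rewrite -!mulrA (mulrA c') Habc -scalerAr mulrBr -scalerAr scalerBr !mulrA.
  by rewrite a'a mul1r scalerA.
have HBC : (c * a + a' * c') * (b * a + a' * b')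
   = q^-1 *: (p * T) - q^-2 *: (p * W) - c * b + r * c
     - q^-1 *: (a' * T) + q^-2 *: (W * a') + s * b - q^-1 *: (a' * T)
     + q^-2 *: (a' * W) + q *: (a' * T) - q ^+ 2 *: (b * c).
  have -> : (c * a + a' * c') * (b * a + a' * b')
     = c * a * a * b + c * a * b' * a' + a' * c' * a * b + a' * c' * b' * a'.
    by rewrite commC mulrDl !mulrDr !mulrA addrA.
  rewrite H1 H2 H3 H4.
  have -> : a' * c * a * b = a' * (c * a * b) by rewrite !mulrA.
  rewrite Hcab.
  rewrite -!scalerAr -!scalerAl mulrBl cT !mulrBr -scalerAl -!scalerAr.
  by lin F R; field.
have G1 : a * b * c * a = q^-1 *: (a * T) - q^-2 *: (c' * b').
  have -> : a * b * c = q^-1 *: T - q^-2 *: (c' * b' * a').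
    by rewrite Habc; lin F R; field.
  by rewrite mulrBl -!scalerAl -!mulrA a'a mulr1 cT.
have G2 : a * b * a' * c' = r * c' - a * W.
  have -> : a * b = r * a - a * b' by rewrite cr mulrDr addrK.
  by rewrite !mulrBl -!(mulrA r) /W !mulrA -(mulrA r a) aa mulr1.
have G3 : b' * a' * c * a = s * b' - W * a.
  have -> : b' * a' * c = s * (b' * a') - W by rewrite cs mulrDr addrK.
  by rewrite mulrBl -!mulrA a'a mulr1.
have G4 : b' * a' * a' * c' = p * W - b' * c'.
  by rewrite -(mulrA b') a'a'2 mulrBr mulrBl mulr1 !mulrA -cp.
have HCB : (b * a + a' * b') * (c * a + a' * c')
   = q^-1 *: (a * T) - q^-2 *: (c' * b') + r * c' - a * W + s * b' - W * a
     + p * W - b' * c'.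
  have -> : (b * a + a' * b') * (c * a + a' * c')
     = a * b * c * a + a * b * a' * c' + b' * a' * c * a + b' * a' * a' * c'.
    by rewrite commC mulrDl !mulrDr !mulrA addrA.
  rewrite G1 G2 G3 G4.
  by lin F R; field.
have Wa' : W * a' = p * W - W * a by rewrite cp mulrDr addrC addKr.
have a'W : a' * W = p * W - a * W by rewrite mulrDl addrC addKr.
have c'b' : c' * b' = r * s - s * b - r * c + c * b.
  have -> : c' = s - c by rewrite addrC addKr.
  have -> : b' = r - b by rewrite addrC addKr.
  have -> : b + (r - b) = r by rewrite addrC subrK.
  have -> : c + (s - c) = s by rewrite addrC subrK.
  by rewrite mulrBl !mulrBr -(cr s) -(cr c); lin F R; ring.
have b'c' : b' * c' = r * s - r * c - s * b + b * c.
  have -> : c' = s - c by rewrite addrC addKr.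
  have -> : b' = r - b by rewrite addrC addKr.
  have -> : b + (r - b) = r by rewrite addrC subrK.
  have -> : c + (s - c) = s by rewrite addrC subrK.
  by rewrite mulrBl !mulrBr -(cs b); lin F R; ring.
have rc' : r * c' = r * s - r * c by rewrite (mulrDr r c) [RHS]addrC addKr.
have sb' : s * b' = r * s - s * b by rewrite cr (mulrDr s b) [RHS]addrC addKr.
rewrite HBC HCB eA Wa' a'W c'b' b'c' rc' sb' !(mulrDl _ _ T) -!scalerAl.
by lin F R; field.
Qed.

End KeyIdentity.
Section Rotation.
Variables (F : fieldType) (q : F) (q0 : q != 0) (q4 : q ^+ 4 != 1).
Variables (R : algType F).
Implicit Types a b c d : R.

Lemma rotate a a' b b' c c' d d' :
  admissible q a a' b b' c c' d d' ->
  admissible q a a' d d' b b' (a' * c * a) (a' * c' * a).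
Proof.
case=> aa a'a bb b'b cc c'c dd d'd cp cr cs cT e.
have es : a' * c * a + a' * c' * a = c + c'.
  by rewrite -mulrDl -mulrDr -cs -mulrA a'a mulr1.
split=> //; last 1 first.
- rewrite !mulrA aa mul1r; have := congr1 (fun z => c * z * c') e.
  by rewrite mulr_algr -scalerAl cc => <-; rewrite -!mulrA cc mulr1.
- by rewrite -!mulrA (mulrA a a') aa mul1r (mulrA c) cc mul1r.
- by rewrite -!mulrA (mulrA a a') aa mul1r (mulrA c') c'c mul1r.
- by rewrite es.
Qed.

Lemma aw_elt_comm a a' b b' c c' d d' y :
  admissible q a a' b b' c c' d d' -> y * a = a * y ->
  y * aw_elt q (d * a + a' * d') (c * a + a' * c') (b * a + a' * b')
  = aw_elt q (d * a + a' * d') (c * a + a' * c') (b * a + a' * b') * y.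
Proof.
move=> h ya; have k := key q0 h.
have q22 : q ^+ 2 - q ^- 2 != 0.
  apply: contra_neq q4 => e.
  have -> : q ^+ 4 = (q ^+ 2 - q ^- 2) * q ^+ 2 + 1 by field.
  by rewrite e mul0r add0r.
have -> : aw_elt q (d * a + a' * d') (c * a + a' * c') (b * a + a' * b')
   = (q ^+ 2 - q ^- 2)^-1 *: ((q - q^-1) *:
       ((q^-1 *: a + q *: a') * (d + d') + (b + b') * (c + c'))).
  rewrite -k scalerDr scalerA mulVf // scale1r /aw_elt addrC.
  by rewrite !scalerBr.
case: h => aa a'a _ _ _ _ _ _ _ cr cs cT _.
have ya' : y * a' = a' * y.
  by rewrite -[y in LHS]mul1r -a'a -(mulrA a') -ya -!mulrA aa mulr1.
rewrite -!scalerAr -!scalerAl; do 2 congr (_ *: _).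
set X := q^-1 *: a + q *: a'.
have yX : y * X = X * y.
  by rewrite /X mulrDr mulrDl -!scalerAr -!scalerAl ya ya'.
rewrite [LHS]mulrDr [RHS]mulrDl -!mulrA cT cs !mulrA yX.
by rewrite (cr y).
Qed.

End Rotation.

(* The images of A, B, C satisfy the relations of [Delta q] in any algebra
   satisfying the relations of [Hhat q0]. *)
Section PsiRelations.
Variables (F : fieldType) (q : F) (q0 : q != 0) (q4 : q ^+ 4 != 1).
Variables (R : unitAlgType F) (t : 'I_4 -> R).
Hypothesis t_unit : forall i, t i \is a GRing.unit.
Hypothesis t_central : forall i, central (t i + (t i)^-1).
Hypothesis t_prod : t 0 * t 1 * t 2 * t 3 = q^-1%:A.

Definition psi_gen (i : 'I_3) : R :=
  nth 0 [:: t 1 * t 0 + (t 1 * t 0)^-1;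
            t 3 * t 0 + (t 3 * t 0)^-1;
            t 2 * t 0 + (t 2 * t 0)^-1] i.

Lemma t_admissible : admissible q (t 0) (t 0)^-1 (t 2) (t 2)^-1
  (t 3) (t 3)^-1 (t 1) (t 1)^-1.
Proof. by split; rewrite ?mulrV ?mulVr. Qed.

Lemma t0_comm i : (t i * t 0 + (t 0)^-1 * (t i)^-1) * t 0
                  = t 0 * (t i * t 0 + (t 0)^-1 * (t i)^-1).
Proof.
have e : t i * t 0 + (t 0)^-1 * (t i)^-1 = t 0 * t i + (t i)^-1 * (t 0)^-1.
  by apply: (@sum_inv_comm F); rewrite ?mulrV ?mulVr.
rewrite [in LHS]e mulrDl mulrDr -!mulrA mulVr // mulr1.
by rewrite (mulrA (t 0) (t 0)^-1) mulrV // mul1r.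
Qed.

Lemma t0_conj i :
  ((t 0)^-1 * t i * t 0) * t 0 + (t 0)^-1 * ((t 0)^-1 * (t i)^-1 * t 0)
  = t i * t 0 + (t 0)^-1 * (t i)^-1.
Proof.
transitivity ((t 0)^-1 * ((t i * t 0 + (t 0)^-1 * (t i)^-1) * t 0)).
  by rewrite mulrDl mulrDr !mulrA.
by rewrite t0_comm mulrA mulVr ?mul1r.
Qed.

Lemma psi_gen_comm y :
  free_eval psi_gen y * t 0 = t 0 * free_eval psi_gen y.
Proof.
rewrite /free_eval /= /free_fun /mmap mulr_suml mulr_sumr; apply: eq_bigr => m _.
rewrite /= !mulr_algl -scalerAl -scalerAr; congr (_ *: _).
rewrite /eval_mon; apply/esym/(@commr_prod _ _ _ _ _ (t 0)) => i _.
apply/esym; case: i => [[|[|[|//]]] lt]; rewrite /psi_gen /= invrM //;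
  exact: t0_comm.
Qed.

Lemma psi_rel x : Delta_rel q x -> free_eval psi_gen x = 0.
Proof.
pose sh i := t i * t 0 + (t 0)^-1 * (t i)^-1.
have shE i : t i * t 0 + (t i * t 0)^-1 = sh i by rewrite invrM.
have h1 := t_admissible; have h2 := rotate h1; have h3 := rotate h2.
have ya y := psi_gen_comm y.
case=> y; apply: rmorph_commutator; move: (ya y) => /=;
  move: (free_eval psi_gen y) => z za; rewrite rmorph_aw_elt !free_evalE /psi_gen /= !shE;
  symmetry.
- exact: (aw_elt_comm q0 q4 h1 za).
- by have := aw_elt_comm q0 q4 h2 za; rewrite !t0_conj.
- by have := aw_elt_comm q0 q4 h3 za; rewrite !t0_conj.
Qed.

End PsiRelations.

Section Psi.
Variables (F : fieldType) (q : F) (q0 : q != 0) (q4 : q ^+ 4 != 1).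
Local Notation t := (tgen q0).

Definition psi : {lrmorphism Delta q -> Hhat q0} :=
  quot_lift (@Delta_proper F q)
    (psi_rel q0 q4 (tgen_unit q0) (@tgen_central F q q0) (tgen_prod q0)).

Lemma psiA : psi (dA q) = t 1 * t 0 + (t 1 * t 0)^-1.
Proof. by rewrite /psi quot_liftE free_evalE. Qed.
Lemma psiB : psi (dB q) = t 3 * t 0 + (t 3 * t 0)^-1.
Proof. by rewrite /psi quot_liftE free_evalE. Qed.
Lemma psiC : psi (dC q) = t 2 * t 0 + (t 2 * t 0)^-1.
Proof. by rewrite /psi quot_liftE free_evalE. Qed.

End Psi.
Arguments psi : simpl never.

Lemma psi_unique (F : fieldType) (q : F) (q0 : q != 0) (q4 : q ^+ 4 != 1)
    (f : {lrmorphism Delta q -> Hhat q0}) :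
  f (dA q) = psi q0 q4 (dA q) -> f (dB q) = psi q0 q4 (dB q) ->
  f (dC q) = psi q0 q4 (dC q) -> f =1 psi q0 q4.
Proof.
move=> fA fB fC; elim/quotW => x.
pose f' : {lrmorphism _ -> _} := f \o to_quot (@Delta_proper F q).
pose g' : {lrmorphism _ -> _} := psi q0 q4 \o to_quot (@Delta_proper F q).
apply: (free_eval_eq (f := f') (g := g')) => -[[|[|[|//]]] lt].
- by have -> : Ordinal lt = 0 by apply: val_inj.
- by have -> : Ordinal lt = 1 by apply: val_inj.
- by have -> : Ordinal lt = 2 by apply: val_inj.
Qed.

(* Main.v *)
Require Import Defs.
From mathcomp Require Import all_boot all_order all_algebra.
From mathcomp Require Import ring.
Set Implicit Arguments.
Unset Strict Implicit.
Unset Printing Implicit Defensive.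
Import GRing.Theory.
Local Open Scope ring_scope.

(** Write a, b, c, d for t_0, t_2, t_3, t_1, a prime for an inverse, T, r, s
    for the central elements d + d', b + b', c + c', and
      A = d a + (d a)^-1,   B = c a + (c a)^-1,   C = b a + (b a)^-1,
      X = q^-1 a + q a'.
    Call an element y a + (y a)^-1 a loop.  The loops A, B, C are the images of
    the generators; they commute with a, hence with X.  The images of alpha,
    beta, gamma are
      alpha = X T + r s,   beta = X s + T r,   gamma = X r + s T
    ([aw_center], used for the given quadruple and for its two rotations).

    The only cubic term of the Casimir element is A C B, and it is computed as
    a product of loops, two at a time.  By [skein_CB],
      C B = alpha - q^-1 A - q A2,
    where the loop A2 is A with d replaced by its conjugate e = b' d b.
    Substituting this into Omega cancels A alpha and A^2 and leaves
      Omega = - A A2 + q^-2 B^2 + q^2 C^2 - q^-1 B beta - q C gamma,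
    so that everything rests on the product A A2 ([skein_AA2]).

    Expanding A A2 from A = d a + a' d' and A2 = e a + a' e' gives four words.
    The relation a d b c = q^-1 turns d b, e, d' into scalar multiples of words
    in the other letters, and quadratic relations such as
    a^2 = (a + a') a - 1 shorten the result.  After this B^2 comes out of
    (d b)^2, since B is also a combination of d b and its inverse, and C^2 comes
    out of (b a)^2.  The terms B beta and C gamma come mostly from the identity
      y a - a' y = (y a + a' y') - (y + y') a'   ([slide]),
    which trades the failure of y to pass a for a loop. *)

(** * Loops through a *)

Section Commutation.
Variables (F : fieldType) (R : algType F) (a a' y y' : R).
Hypotheses (aa : a * a' = 1) (a'a : a' * a = 1) (ca : central (a + a')).
Hypotheses (yy : y * y' = 1) (y'y : y' * y = 1) (cy : central (y + y')).

(** The word y a and its inverse do not commute with a separately; their sum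
    does, because it does not depend on the order of the factors y and a. *)
Lemma curve_comm : a' * (y * a + a' * y') = (y * a + a' * y') * a'.
Proof.
rewrite [in LHS](sum_inv_comm yy y'y aa a'a cy ca).
by rewrite mulrDl mulrDr !mulrA a'a mul1r -(mulrA y) aa mulr1.
Qed.

(** Moving a' across y turns it into a, with a loop and a central multiple of a'
    as correction. *)
Lemma slide : y * a - a' * y = (y * a + a' * y') - (y + y') * a'.
Proof. by rewrite cy mulrDr; lin F R; ring. Qed.

Lemma conj_sum : a' * y * a + a' * y' * a = y + y'.
Proof. by rewrite -mulrDl -mulrDr -cy -mulrA a'a mulr1. Qed.

(** The left-hand side is the whole loop conjugated by a, with which it
    commutes. *)
Lemma conj_curve :
  (a' * y * a) * a + a' * (a' * y' * a) = y * a + a' * y'.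
Proof.
transitivity (a' * (y * a + a' * y') * a).
  by rewrite mulrDr mulrDl !mulrA.
by rewrite curve_comm -mulrA a'a mulr1.
Qed.

End Commutation.

(** * Products of two loops *)

Section Curves.
Variables (F : fieldType) (q : F) (q0 : q != 0) (R : algType F).
Variables (a a' b b' c c' d d' : R).
Hypothesis h : admissible q a a' b b' c c' d d'.
Local Notation r := (b + b').
Local Notation s := (c + c').
Local Notation T := (d + d').
Local Notation A := (d * a + a' * d').
Local Notation B := (c * a + a' * c').
Local Notation C := (b * a + a' * b').
Local Notation X := (q^-1 *: a + q *: a').
Local Notation e := (b' * d * b).
Local Notation e' := (b' * d' * b).
Local Notation A2 := (e * a + a' * e').

Lemma prod_db : d * b = q^-1 *: (a' * c').
Proof.
have [-> _] := admE q0 h; case: h => _ _ _ b'b _ _ _ _ _ _ _ _ _.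
by rewrite -scalerAl -!mulrA b'b mulr1.
Qed.

Lemma conj_d : e = q^-1 *: (b' * a' * c') /\ e' = q *: (c * a * b).
Proof.
have [_ ->] := admE q0 h; split.
  by rewrite -mulrA prod_db -scalerAr mulrA.
case: h => _ _ _ b'b _ _ _ _ _ _ _ _ _.
by rewrite -scalerAr -scalerAl !mulrA b'b mul1r.
Qed.

Lemma conj_T : e + e' = T.
Proof.
case: h => _ _ _ b'b _ _ _ _ _ _ _ cT _.
exact: (conj_sum b'b cT).
Qed.

Lemma comm_B : a' * B = B * a'.
Proof.
by case: h => aa a'a _ _ cc c'c _ _ cp _ cs _ _; exact: curve_comm.
Qed.

Lemma comm_C : a' * C = C * a'.
Proof.
by case: h => aa a'a bb b'b _ _ _ _ cp cr _ _ _; exact: curve_comm.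
Qed.

(** The words match in groups.  Of q a' T = q a' e + q a' e' in X T, the second
    term is in q A2 and the first is the word a' b' a' c' of C B.  Likewise
    a T = d a + d' a accounts for A up to d' a - a' d'.  The remaining words are
    those of r s = r a' (c + c') a, once d' = q b c a is substituted. *)
Lemma skein_CB : C * B = X * T + r * s - q^-1 *: A - q *: A2.
Proof.
have [_ d'E] := admE q0 h; have [eE e'E] := conj_d; have eT := conj_T.
case: h => aa a'a bb b'b cc c'c dd d'd cp cr cs cT _.
have commB : c * a + a' * c' = a * c + c' * a' by exact: sum_inv_comm.
have aT : a * T = d * a + d' * a by rewrite -cT mulrDl.
have a'T : q *: (a' * T) = a' * b' * a' * c' + q *: (a' * e').
  by rewrite -eT eE mulrDr scalerDr -scalerAr scalerA divff // scale1r !mulrA.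
have ca2 : b * c * a * a = b * a * c * a + b * c' - b * a' * c' * a.
  have := congr1 (fun z => b * (z * a)) commB.
  rewrite /= !mulrDl !mulrDr !mulrA -(mulrA _ a' a) a'a mulr1.
  by move/(canRL (addrK _)) ->.
have rs : r * s = b * a' * c' * a + b' * a' * c' * a
                  + (a' * b * c * a + a' * b' * c * a).
  have -> : r * s = r * (a' * s * a) by rewrite -mulrA cs (mulrA a') a'a mul1r.
  rewrite [a' * s]mulrDr mulrDl mulrDr addrC; congr (_ + _).
    by rewrite mulrDl !mulrA.
  by rewrite !mulrA cr mulrDr !mulrDl.
rewrite (mulrDl _ _ T) -!scalerAl aT a'T rs.
have -> : C * B = b * a * c * a + b * c' + a' * b' * c * a + a' * b' * a' * c'.
  by rewrite mulrDl !mulrDr !mulrA -(mulrA b a a') aa mulr1 !addrA.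
have -> : e * a = q^-1 *: (b' * a' * c' * a) by rewrite eE -scalerAl.
have -> : d' * a = q *: (b * a * c * a + b * c' - b * a' * c' * a).
  by rewrite d'E -scalerAl ca2.
have -> : a' * d' = q *: (a' * b * c * a) by rewrite d'E -scalerAr !mulrA.
by lin F R; field.
Qed.

(** As e is a conjugate of d by b, the word d e = d b' d b becomes a quadratic
    expression in d b once b' is replaced by r - b. *)
Lemma de_quadratic : d * e = T * r * (d * b) - r * b - d * b * (d * b).
Proof.
case: h => _ _ _ _ _ _ _ d'd _ cr _ cT _.
have -> : b' * d * b = r * (d * b) - b * (d * b).
  by rewrite -mulrBl -mulrA addrC addKr.
have Tdd : T * (d * b) = d * d * b + b.
  by rewrite mulrDl !mulrA d'd mul1r.
rewrite mulrBr (mulrA d) -(cr d) -(mulrA r) (cT r) -(mulrA r T) Tdd mulrDr.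
by rewrite !mulrA addrK.
Qed.

(** The loop B is also q (d b) + q^-1 (d b)^-1, because d b = q^-1 a' c' and
    (d b)^-1 = q c a; the identity is the resulting quadratic equation. *)
Lemma db_quadratic : d * b * (d * b) = q^-1 *: (B * (d * b)) - q ^- 2 *: 1.
Proof.
rewrite prod_db; case: h => aa a'a bb b'b cc c'c _ _ _ _ _ _ _.
rewrite mulrDl -!scalerAr -!scalerAl !mulrA -(mulrA _ a a') aa mulr1 cc.
by lin F R; field.
Qed.

Lemma slide_db : d * b * a - a' * (d * b) = q^-1 *: (s - B * a').
Proof.
rewrite prod_db; case: (h) => _ a'a _ _ _ _ _ _ _ _ cs _ _.
have a'B := comm_B.
have sB : s - B * a' = a' * (s * a - B).
  by rewrite -a'B mulrBr (cs a) (mulrA a') a'a mul1r.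
rewrite sB mulrDl.
have -> : c * a + c' * a - (c * a + a' * c') = c' * a - a' * c'.
  by lin F R; ring.
by rewrite -scalerAl -scalerAr -scalerBr mulrBr !mulrA.
Qed.

(** The quadratic expression for d e is slid past a term by term, by [slide] for
    b and [slide_db] for d b; B itself slides for free.  The terms B^2, T r B
    and r C a of A A2 are produced here. *)
Lemma slide_de : (d * e * a - a' * (d * e)) * a =
  q^-1 *: (T * r * (s * a) - T * r * B) - (r * (C * a) - r * r)
  - q ^- 2 *: (B * (s * a) - B * B) + q ^- 2 *: (a * a - 1).
Proof.
have a'B := comm_B; have sdb := slide_db.
have dede := de_quadratic; have dbdb := db_quadratic.
case: h => aa a'a _ _ _ _ _ _ _ cr cs cT _.
have E : d * e * a - a' * (d * e) =
    T * r * (d * b * a - a' * (d * b)) - r * (b * a - a' * b)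
    - q^-1 *: (B * (d * b * a - a' * (d * b))) + q ^- 2 *: (a - a').
  rewrite dede dbdb !mulrBl !mulrBr -!scalerAr -!scalerAl.
  have -> : a' * (T * r * (d * b)) = T * r * (a' * (d * b)).
    rewrite (mulrA a') [a' * (T * r)]mulrA -(cT a') -(mulrA T) -(cr a').
    by rewrite !mulrA.
  have -> : a' * (r * b) = r * (a' * b) by rewrite mulrA -(cr a') mulrA.
  have -> : a' * (B * (d * b)) = B * (a' * (d * b)).
    by rewrite mulrA a'B -mulrA.
  rewrite mul1r mulr1 -!(mulrA _ _ a).
  by lin F R; ring.
have Baa : B * a' * a = B by rewrite -mulrA a'a mulr1.
rewrite E sdb (slide _ _ cr) -!scalerAr scalerA.
rewrite [LHS]mulrDl 2!mulrBl -!scalerAl.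
have -> : T * r * (s - B * a') * a = T * r * (s * a) - T * r * B.
  by rewrite -mulrA mulrBl Baa mulrBr.
have -> : r * (C - r * a') * a = r * (C * a) - r * r.
  by rewrite -mulrA mulrBl -(mulrA r) a'a mulr1 mulrBr.
have -> : B * (s - B * a') * a = B * (s * a) - B * B.
  by rewrite -mulrA mulrBl Baa mulrBr.
rewrite mulrBl a'a.
by lin F R; field.
Qed.

(** The aim is to have d and e adjacent, as d e is known.  Centrality of a + a'
    moves the a out of d a e a, and d' = T - d, e' = T - e treat a' d' e a and
    d e'.  The leftovers of the first and third word merge into d' a' e a, and
    the fourth word is kept. *)
Lemma mul_A_A2 : A * A2 = T * d + (d * e * a - a' * (d * e)) * a
                          + d' * a' * e * a + a' * d' * a' * e'.
Proof.
have eT := conj_T; case: h => aa a'a _ _ _ _ _ _ cp _ _ cT _.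
move: e e' eT => u u' eT.
have du' : d * u' = T * d - d * u by rewrite cT -eT mulrDr addrC addKr.
have dua : d * u * a * a = d * a * u * a + d * a' * u * a - d * u.
  have : d * (a + a') * u * a = d * u * (a + a') * a by rewrite -!(mulrA d) cp.
  rewrite !(mulrDl, mulrDr) -(mulrA _ a' a) a'a mulr1.
  by move=> ->; rewrite addrK.
have Tua : a' * d' * u * a
           = d * a' * u * a + d' * a' * u * a - a' * d * u * a.
  by rewrite -!mulrDl cT mulrDr !mulrDl addrC addKr.
rewrite mulrDl !mulrDr !mulrA -(mulrA d a a') aa mulr1 du' Tua mulrBl dua.
by lin F R; ring.
Qed.

Lemma prod_d'a' : d' * a' = q *: (b * c).
Proof.
have [_ ->] := admE q0 h; case: h => aa _ _ _ _ _ _ _ _ _ _ _ _.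
by rewrite -scalerAl -(mulrA _ a) aa mulr1.
Qed.

(** In the letters a, b, c the word contains c^2 = s c - 1, and then
    b a b = b C - a'. *)
Lemma word_a'd'a'e' : a' * d' * a' * e'
  = q *: (s * a' * d' * b) - q ^+ 2 *: (a' * b * C) + q ^+ 2 *: (a' * a').
Proof.
have [_ d'E] := admE q0 h; have [_ e'E] := conj_d; have d'a'E := prod_d'a'.
case: h => aa a'a bb b'b cc c'c _ _ cp cr cs _ _.
have commC : b * a + a' * b' = a * b + b' * a'.
  by exact: (sum_inv_comm (F := F)).
have cc2 : c * c = s * c - 1 by rewrite mulrDl c'c addrK.
have bab : b * a * b = b * C - a'.
  by rewrite commC mulrDr !mulrA bb mul1r addrK.
rewrite -(mulrA a') d'a'E e'E -!(scalerAl, scalerAr) scalerA !mulrA.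
have -> : a' * b * c * c * a * b
          = s * a' * (b * c * a) * b - a' * (b * a * b).
  rewrite -(mulrA _ c c) cc2 mulrBr mulr1 (mulrA (a' * b)) -(cs (a' * b)).
  by rewrite !mulrBl !mulrA.
rewrite bab d'E -!(scalerAl, scalerAr) mulrBr !mulrA.
by lin F R; field.
Qed.

(** The word is b c b' a' c' a.  With c = s - c' it splits into a multiple of s
    and a word containing c' b' a' c', which T c' turns into (b a)^2. *)
Lemma word_d'a'ea : d' * a' * e * a
  = s * (a' * c' * a) + q ^+ 2 *: (b * a * b * a) - q *: (T * (b * c' * a)).
Proof.
have [dE d'E] := admE q0 h; have [eE _] := conj_d; have d'a'E := prod_d'a'.
case: h => aa _ bb _ cc _ _ _ _ _ cs cT _.
have Tc' : T * c' = q *: (a * b) + q^-1 *: (c' * b' * a' * c').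
  have -> : T * c' = a * T * a' * c' by rewrite -cT -(mulrA T) aa mulr1.
  rewrite [a * T]mulrDr dE {1}d'E !mulrDl -!(scalerAl, scalerAr) !mulrA aa.
  by rewrite mul1r -(mulrA _ a a') aa mulr1 -(mulrA _ c c') cc mulr1 addrC.
rewrite d'a'E eE -!(scalerAl, scalerAr) scalerA mulfV // scale1r.
have -> : T * (b * c' * a) = b * (T * c') * a by rewrite !mulrA cT.
rewrite Tc' mulrDr mulrDl -!(scalerAl, scalerAr) !mulrA.
have -> : s * a' * c' * a
          = b * c * b' * a' * c' * a + b * c' * b' * a' * c' * a.
  by rewrite -[s]mul1r -bb -(mulrA b) -cs !(mulrDr, mulrDl) !mulrA.
by lin F R; field.
Qed.

Lemma square_C : b * a * b * a = a' * b * C + C * C - r * (C * a') - 1.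
Proof.
have a'C := comm_C; case: h => aa _ bb _ _ _ _ _ _ cr _ _ _.
have baC : b * a * C = b * a * b * a + 1.
  by rewrite mulrDr !mulrA -(mulrA _ a a') aa mulr1 bb.
have a'bE z : a' * b * z = r * (a' * z) - a' * b' * z.
  by rewrite mulrA cr mulrDr mulrDl addrK.
by rewrite a'bE a'C [C * C]mulrDl baC; lin F R; ring.
Qed.

Lemma word_sa'c'a :
  s * (a' * c' * a) = s * s - s * B * a' + q *: (s * a' * d * b).
Proof.
have a'B := comm_B; case: (h) => _ a'a _ _ _ _ _ _ _ _ cs _ _.
have : a' * c' * a - a' * a' * c' = s - B * a'.
  rewrite -a'B; have -> : s = a' * (s * a) by rewrite cs mulrA a'a mul1r.
  by rewrite -mulrBr mulrDl opprD addrACA subrr add0r mulrBr !mulrA.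
move/(canRL (subrK _)) => ->.
rewrite mulrDr mulrBr (mulrA s B); congr (_ + _).
have -> : s * a' * d * b = s * a' * (d * b) by rewrite mulrA.
by rewrite prod_db -scalerAr scalerA mulfV // scale1r !mulrA.
Qed.

(** These are the terms of A A2 outside the squares and the other products with
    B and C.  They combine into T^2 and a multiple of T s because a' d b and
    a' d' b add up to T a' b, and b a - a' b = C - r a' by [slide]. *)
Lemma word_Td : T * d
  = T * T - q *: (T * s * C) + q *: (T * r * s * a')
    + q *: (T * (b * c' * a)) - q *: (s * a' * d' * b) - q *: (s * a' * d * b).
Proof.
have [_ d'E] := admE q0 h; case: h => _ _ _ _ _ _ _ _ _ cr cs cT _.
have bc'a : q *: (b * c' * a) = q *: (s * (b * a)) - d'.
  rewrite d'E -scalerBr; congr (_ *: _).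
  by rewrite mulrA cs mulrDr mulrDl addrC addKr.
have sTa'b : s * a' * d' * b + s * a' * d * b = T * s * (a' * b).
  by rewrite -mulrDl -mulrDr [d' + d]addrC -cT !mulrA.
have CE : C = b * a - a' * b + r * a' by rewrite (slide _ _ cr) subrK.
have -> : T * d = T * T - T * d' by rewrite mulrDr addrK.
have -> : q *: (T * (b * c' * a)) = q *: (T * s * (b * a)) - T * d'.
  by rewrite scalerAr bc'a mulrBr -scalerAr (mulrA T s).
have -> : T * r * s * a' = T * s * (r * a') by rewrite -(mulrA T) cr !mulrA.
rewrite CE (mulrDr (T * s)) (mulrBr (T * s)) -sTa'b.
by lin F R; ring.
Qed.

(** The product is the sum of the words computed above; here the right-hand side
    is brought to the same normal form, central factors first and a or a'
    last. *)
Lemma skein_AA2 : A * A2 =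
  q ^- 2 *: (B * B) - q^-1 *: (B * (X * s + T * r))
  + q ^+ 2 *: (C * C) - q *: (C * (X * r + s * T))
  + X * X + T * T + r * r + s * s + X * T * r * s - (q + q^-1) ^+ 2 *: 1.
Proof.
rewrite mul_A_A2 word_a'd'a'e' word_d'a'ea word_sa'c'a slide_de.
rewrite square_C word_Td.
case: h => aa a'a _ _ _ _ _ _ _ cr cs cT _.
have -> : X * X = q ^- 2 *: (a * a) + q ^+ 2 *: (a' * a') + 2 *: 1.
  rewrite mulrDr !mulrDl -!(scalerAl, scalerAr) aa a'a.
  by lin F R; field.
have -> : B * (X * s + T * r)
          = q^-1 *: (B * (s * a)) + q *: (s * B * a') + T * r * B.
  have -> : X * s + T * r = q^-1 *: (s * a) + q *: (a' * s) + T * r.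
    by rewrite [X * s]mulrDl -!scalerAl cs.
  rewrite !(mulrDr B) -!scalerAr; congr (_ + _ + _).
    by rewrite -(cs a') (mulrA B) -(cs B).
  by rewrite (mulrA B) -(cT B) -!(mulrA T) (cr B).
have -> : C * (X * r + s * T)
          = q^-1 *: (r * (C * a)) + q *: (r * (C * a')) + T * s * C.
  have -> : X * r + s * T = q^-1 *: (a * r) + q *: (a' * r) + T * s.
    by rewrite [X * r]mulrDl -!scalerAl cT.
  rewrite !(mulrDr C) -!scalerAr !(mulrA C); congr (_ *: _ + _ *: _ + _).
  - by rewrite cr.
  - by rewrite cr.
  - by rewrite -(cT C) -!(mulrA T) (cs C).
have -> : X * T * r * s = q^-1 *: (T * r * (s * a)) + q *: (T * r * s * a').
  have -> : X * T * r * s = T * r * s * X.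
    by rewrite -(cT X) -(mulrA T X) -(cr X) -!mulrA -(cs X).
  by rewrite (mulrDr (T * r * s)) -!scalerAr (mulrA (T * r)).
by lin F R; field.
Qed.

End Curves.

(** * The Casimir element *)

Section Casimir.
Variables (F : fieldType) (q : F) (q0 : q != 0) (q4 : q ^+ 4 != 1).
Variable R : algType F.
Implicit Types a b c d : R.

(** This is [key] divided by q - q^-1, which does not vanish since
    (q - q^-1) (q + q^-1) q^2 = q^4 - 1. *)
Lemma aw_center a a' b b' c c' d d' :
  admissible q a a' b b' c c' d d' ->
  (q + q^-1) *:
    aw_elt q (d * a + a' * d') (c * a + a' * c') (b * a + a' * b')
  = (q^-1 *: a + q *: a') * (d + d') + (b + b') * (c + c').
Proof.
move=> h; have k := key q0 h.
have q22 : q ^+ 2 - q ^- 2 = (q - q^-1) * (q + q^-1) by field.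
have: (q - q^-1) * (q + q^-1) != 0.
  apply: contra_neq q4 => e.
  have -> : q ^+ 4 = (q - q^-1) * (q + q^-1) * q ^+ 2 + 1 by field.
  by rewrite e mul0r add0r.
rewrite mulf_eq0 negb_or => /andP[qB qD].
apply: (scalerI qB); rewrite -k /aw_elt.
rewrite q22 scalerA scalerDr scalerA mulfV ?mulf_neq0 // scale1r.
by rewrite addrC.
Qed.

Lemma casimir a a' b b' c c' d d' :
  admissible q a a' b b' c c' d d' ->
  let A := d * a + a' * d' in
  let B := c * a + a' * c' in
  let C := b * a + a' * b' in
  let X := q^-1 *: a + q *: a' in
  q^-1 *: (A * C * B) + q ^- 2 *: A ^+ 2 + q ^- 2 *: B ^+ 2 + q ^+ 2 *: C ^+ 2
  - q^-1 *: (A * ((q + q^-1) *: aw_elt q A B C))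
  - q^-1 *: (B * ((q + q^-1) *: aw_elt q B C A))
  - q *: (C * ((q + q^-1) *: aw_elt q C A B))
  = ((q + q^-1) ^+ 2)%:A - X ^+ 2 - (d + d') ^+ 2 - (b + b') ^+ 2
    - (c + c') ^+ 2 - X * (d + d') * (b + b') * (c + c').
Proof.
move=> h A B C X.
(* A rotation permutes A, B, C cyclically, up to conjugating c or b by a. *)
have h1 := aw_center h; have h2 := aw_center (rotate h).
have h3 := aw_center (rotate (rotate h)).
have cb := skein_CB q0 h; have ab := skein_AA2 q0 h.
case: h => aa a'a bb b'b cc c'c dd d'd cp cr cs cT _.
rewrite !(conj_sum, conj_curve) // in h2 h3.
rewrite -/A -/B -/C -/X in h1 h2 h3 cb ab.
rewrite h1 h2 h3 -(mulrA A) cb.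
rewrite !expr2 2!mulrBr -!scalerAr ab.
by lin F R; field.
Qed.

End Casimir.

Section Morphism.
Variables (F : fieldType) (q : F) (R S : algType F) (f : {lrmorphism R -> S}).

Lemma rmorph_aw_scale k x y z :
  f (k *: aw_elt q x y z) = k *: aw_elt q (f x) (f y) (f z).
Proof. by rewrite linearZ /= rmorph_aw_elt. Qed.

Lemma rmorph_casimir x y z u v w :
  f (q^-1 *: (x * z * y) + q ^- 2 *: x ^+ 2 + q ^- 2 *: y ^+ 2
     + q ^+ 2 *: z ^+ 2 - q^-1 *: (x * u) - q^-1 *: (y * v) - q *: (z * w))
  = q^-1 *: (f x * f z * f y) + q ^- 2 *: f x ^+ 2 + q ^- 2 *: f y ^+ 2
     + q ^+ 2 *: f z ^+ 2 - q^-1 *: (f x * f u) - q^-1 *: (f y * f v)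
     - q *: (f z * f w).
Proof.
have fZ k g : f (k *: g) = k *: f g by rewrite linearZ.
by rewrite !rmorphB !rmorphD /= !fZ !rmorphXn !rmorphM.
Qed.

End Morphism.

Theorem theorem4p4 (F : fieldType) (q : F) (q0 : q != 0) (q4 : q ^+ 4 != 1) :
  psi q0 q4 (Omega q)
  = ((q + q^-1) ^+ 2)%:A
    - (q^-1 *: tgen q0 0 + q *: (tgen q0 0)^-1) ^+ 2
    - (tgen q0 1 + (tgen q0 1)^-1) ^+ 2
    - (tgen q0 2 + (tgen q0 2)^-1) ^+ 2
    - (tgen q0 3 + (tgen q0 3)^-1) ^+ 2
    - (q^-1 *: tgen q0 0 + q *: (tgen q0 0)^-1)
      * (tgen q0 1 + (tgen q0 1)^-1)
      * (tgen q0 2 + (tgen q0 2)^-1)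
      * (tgen q0 3 + (tgen q0 3)^-1).
Proof.
rewrite /Omega rmorph_casimir /alpha /beta /gamma !rmorph_aw_scale.
rewrite psiA psiB psiC.
have tV i : (tgen q0 i * tgen q0 0)^-1 = (tgen q0 0)^-1 * (tgen q0 i)^-1.
  by rewrite invrM ?tgen_unit.
rewrite !tV; apply: (casimir q0 q4).
exact: (t_admissible (tgen_unit q0) (@tgen_central F q q0) (tgen_prod q0)).
Qed.
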